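(* Let $p, x \ge 2$ be integers with $(p,x) \neq (2,2)$, and let \[ S = \langle p^x - 2,\ 2(p^x-2)+1,\ 2(p^x-2)+p,\ \ldots,\ 2(p^x-2)+p^{x-1} \rangle \] be the numerical semigroup with the $x+1$ generators $n_0 = p^x-2$ and $n_i = 2(p^x-2)+p^{i-1}$ for $1 \le i \le x$. Then a minimal presentation of $S$ has size $x+1$ and is given by the following elements of $\mathbb{N}^{x+1}\times\mathbb{N}^{x+1}$ (coordinates of $\mathbb{N}^{x+1}$ are indexed by $0,1,\ldots,x$): \[ \big((2p-3,2,0,\ldots,0),\ (0,\ldots,0,p)\big), \qquad \big((2x(p-1)-1,0,\ldots,0),\ (0,p-2,p-1,\ldots,p-1)\big), \] and, for each $i \in \{1,\ldots,x-1\}$, \[ v_i := \big((0,\ldots,0,p,0,\ldots,0),\ (2(p-1),0,\ldots,0,1,0,\ldots,0)\big), \] where in $v_i$ the entry $p$ of the left tuple is in position $i$ and the entry $1$ of the right tuple is in position $i+1$ (positions counted starting at $0$).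
   Context: $\mathbb{N} = \{0,1,2,\ldots\}$. A numerical semigroup is an additive submonoid $S$ of $\mathbb{N}$ with finite complement. Every numerical semigroup has a unique minimal generating set, and $S = \langle n_0,\ldots,n_x\rangle$ means that $\{n_0,\ldots,n_x\}$ is the minimal generating set of $S$. The factorization homomorphism is $\varphi : \mathbb{N}^{x+1} \to S$, $\varphi(a_0,\ldots,a_x) = a_0 n_0 + \cdots + a_x n_x$. The kernel congruence $\sim$ of $\varphi$ is defined by $u \sim v$ iff $\varphi(u) = \varphi(v)$. A congruence on $\mathbb{N}^{x+1}$ is an equivalence relation compatible with addition; the congruence generated by $\rho \subseteq \mathbb{N}^{x+1}\times\mathbb{N}^{x+1}$ is the least congruence containing $\rho$. A presentation of $S$ is a set $\rho$ that generates $\sim$ as a congruence; it is minimal if it is a minimal system of generators of this congruence, i.e. no proper subset of it generates $\sim$. *)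

(* Defs.v *)
From HB Require Import structures.
From mathcomp Require Import all_boot all_order all_algebra.
From mathcomp Require Import boolp classical_sets functions cardinality.

Set Implicit Arguments.
Unset Strict Implicit.
Unset Printing Implicit Defensive.

Import GRing.Theory.

Local Open Scope classical_set_scope.
Local Open Scope nat_scope.

Definition additive_submonoid (S : set nat) : Prop :=
  S 0 /\ (forall a b, S a -> S b -> S (a + b)).

Definition numerical_semigroup (S : set nat) : Prop :=
  additive_submonoid S /\ finite_set (~` S).

Definition generated_submonoid (A : set nat) : set nat :=
  smallest additive_submonoid A.

Definition minimal_generating_set (S A : set nat) : Prop :=
  generated_submonoid A = S /\
  (forall B : set nat, B `<` A -> generated_submonoid B <> S).

(* [S = <n_0, ..., n_(k-1)>]: the [n_i] are pairwise distinct and form the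
   minimal generating set of [S]. *)
Definition minimally_generated_by (S : set nat) (k : nat) (n : 'I_k -> nat) :
    Prop :=
  injective n /\ minimal_generating_set S (range n).

Definition factorization_hom (k : nat) (n : 'I_k -> nat)
    (a : {ffun 'I_k -> nat}) : nat :=
  \sum_(i < k) a i * n i.

(* Relations on N^k are sets of pairs; the addition of N^k is the pointwise one
   of the library, hence the [%R]. *)
Definition congruence (k : nat)
    (R : set ({ffun 'I_k -> nat} * {ffun 'I_k -> nat})) : Prop :=
  [/\ forall u, R (u, u),
      forall u v, R (u, v) -> R (v, u),
      forall u v w, R (u, v) -> R (v, w) -> R (u, w)
    & forall u v u' v', R (u, v) -> R (u', v') -> R ((u + u')%R, (v + v')%R)].

Definition generated_congruence (k : nat)
    (rho : set ({ffun 'I_k -> nat} * {ffun 'I_k -> nat})) :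
    set ({ffun 'I_k -> nat} * {ffun 'I_k -> nat}) :=
  smallest (@congruence k) rho.

Definition kernel_congruence (k : nat) (n : 'I_k -> nat) :
    set ({ffun 'I_k -> nat} * {ffun 'I_k -> nat}) :=
  [set uv | factorization_hom n uv.1 = factorization_hom n uv.2].

Definition presentation (k : nat) (n : 'I_k -> nat)
    (rho : set ({ffun 'I_k -> nat} * {ffun 'I_k -> nat})) : Prop :=
  generated_congruence rho = kernel_congruence n.

Definition minimal_presentation (k : nat) (n : 'I_k -> nat)
    (rho : set ({ffun 'I_k -> nat} * {ffun 'I_k -> nat})) : Prop :=
  presentation n rho /\
  (forall rho' : set ({ffun 'I_k -> nat} * {ffun 'I_k -> nat}),
     rho' `<` rho -> ~ presentation n rho').

(* All subtractions below are truncated, but exact as soon as [2 <= p] and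
   [2 <= x]. *)
Definition gens (p x : nat) (i : 'I_x.+1) : nat :=
  if i == 0 :> nat then p ^ x - 2 else 2 * (p ^ x - 2) + p ^ (i - 1).

Arguments gens : clear implicits.

Definition rel_first (p x : nat) :
    {ffun 'I_x.+1 -> nat} * {ffun 'I_x.+1 -> nat} :=
  ([ffun j : 'I_x.+1 =>
      if j == 0 :> nat then 2 * p - 3 else if j == 1 :> nat then 2 else 0],
   [ffun j : 'I_x.+1 => if j == x :> nat then p else 0]).

Definition rel_second (p x : nat) :
    {ffun 'I_x.+1 -> nat} * {ffun 'I_x.+1 -> nat} :=
  ([ffun j : 'I_x.+1 => if j == 0 :> nat then 2 * x * (p - 1) - 1 else 0],
   [ffun j : 'I_x.+1 =>
      if j == 0 :> nat then 0 else if j == 1 :> nat then p - 2 else p - 1]).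

Definition rel_v (p x i : nat) :
    {ffun 'I_x.+1 -> nat} * {ffun 'I_x.+1 -> nat} :=
  ([ffun j : 'I_x.+1 => if j == i :> nat then p else 0],
   [ffun j : 'I_x.+1 =>
      if j == 0 :> nat then 2 * (p - 1)
      else if j == i + 1 :> nat then 1 else 0]).

Definition rels (p x : nat) :
    set ({ffun 'I_x.+1 -> nat} * {ffun 'I_x.+1 -> nat}) :=
  [set rel_first p x; rel_second p x]
  `|` [set rel_v p x i | i in [set i : nat | 1 <= i <= x - 1]].

Arguments rels : clear implicits.

(* Main.v *)
Require Import Defs.
From HB Require Import structures.
From mathcomp Require Import all_boot all_order all_algebra zify.
From mathcomp Require Import boolp classical_sets functions cardinality.

Set Implicit Arguments.
Unset Strict Implicit.
Unset Printing Implicit Defensive.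

Local Open Scope classical_set_scope.
Local Open Scope nat_scope.

(** Write m for n_0 = p^x - 2.  For each of the x+1 relations, exactly one side
    does not involve n_0; call it light, and call the other side heavy.  The
    light sides are (0, p-2, p-1, ..., p-1) and the vectors p e_i for
    1 <= i <= x.

    The relations generate the kernel congruence because replacing light sides
    by heavy ones is a complete rewriting system for it.  A replacement
    preserves the value and increases the coefficient of n_0, which the value
    bounds, so rewriting terminates ([kernel_sub_generated]).  A vector u
    containing no light side has entries u_1, ..., u_x below p, to be read as
    the base-p digits of a number N.  Since the digits of p^x - 2 are
    (p-2, p-1, ..., p-1), avoiding the light side of [rel_second] says exactly
    that N < m.  The value of u is a multiple of m plus N, hence its residue
    modulo m gives N, then the digits, and finally u_0 ([reduced_inj]).  So every
    class contains a single irreducible vector.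

    No relation can be dropped because the light sides form an antichain for the
    componentwise order ([light_antichain]), and no heavy side lies below a light
    one since only heavy sides involve n_0.  Without its own relation a light
    side therefore contains no side of any relation, so it is alone in its class
    ([isolated_class]).  The hypothesis (p,x) <> (2,2) is essential here: in the
    excluded case the light side (0,0,1) lies below (0,0,2).

    For the semigroup itself, n_1 = 2m + 1 gives cofiniteness, and the n_i with
    i >= 1 lie strictly between 2m and 3m (again as (p,x) <> (2,2)), whereas a
    non-zero element of S is either a multiple of m or at least 2m; so no
    generator is a sum of two non-zero elements, and every generating set
    contains all of them. *)

(** * Congruences on N^k *)

Local Notation vec k := {ffun 'I_k -> nat}.

Lemma ffun_addE (k : nat) (u v : vec k) (i : 'I_k) :
  (u + v)%R i = u i + v i.
Proof. by rewrite ffunE. Qed.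

Definition vle (k : nat) (u v : vec k) : bool :=
  [forall i, u i <= v i].

Lemma vle_trans (k : nat) (u v w : vec k) :
  vle u v -> vle v w -> vle u w.
Proof.
move=> /forallP uv /forallP vw; apply/forallP => i.
exact: leq_trans (uv i) (vw i).
Qed.

Lemma vle_addr (k : nat) (u v : vec k) : vle u (u + v)%R.
Proof. by apply/forallP => i; rewrite ffun_addE leq_addr. Qed.

Lemma vle_subK (k : nat) (u v : vec k) :
  vle u v -> exists w, v = (u + w)%R.
Proof.
move=> /forallP uv; exists [ffun i => v i - u i].
by apply/ffunP => i; rewrite ffun_addE ffunE subnKC.
Qed.

Lemma factorization_homD (k : nat) (n : 'I_k -> nat)
    (u v : vec k) :
  factorization_hom n (u + v)%R = factorization_hom n u + factorization_hom n v.
Proof.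
rewrite /factorization_hom -big_split /=; apply: eq_bigr => i _.
by rewrite ffun_addE mulnDl.
Qed.

Lemma kernel_congruenceP (k : nat) (n : 'I_k -> nat) :
  congruence (kernel_congruence n).
Proof.
rewrite /kernel_congruence; split => //= [u v w -> //|u v u' v' e e'].
by rewrite !factorization_homD e e'.
Qed.

Lemma factorization_hom_axis (k : nat) (n : 'I_k -> nat) (i : 'I_k) (c : nat) :
  factorization_hom n [ffun j : 'I_k => if j == i :> nat then c else 0] =
  c * n i.
Proof.
rewrite /factorization_hom (bigD1 i) //= ffunE eqxx big1 ?addn0 // => j ji.
by rewrite ffunE ifF //; apply/negbTE.
Qed.

Lemma generated_congruenceP (k : nat)
    (rho : set (vec k * vec k)) :
  congruence (generated_congruence rho).
Proof.
split=> [u R [[]] //|u v h R cR|u v w h h' R cR|u v u' v' h h' R cR].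
- by case: (cR) => -[_ s _ _] _; apply: s; apply: h.
- by case: (cR) => -[_ _ t _] _; apply: t (h _ cR) (h' _ cR).
- by case: (cR) => -[_ _ _ a] _; apply: a (h _ cR) (h' _ cR).
Qed.

(** A completeness criterion for rewriting the vectors [l a] into [h a].  Each
    step raises coordinate [i0] at constant value, so the difference between the
    value and that coordinate is a decreasing natural number.  Confluence need
    not be checked: uniqueness of irreducible vectors in each fibre gives it. *)
Lemma kernel_sub_generated (k : nat) (n : 'I_k -> nat) (i0 : 'I_k) (I : Type)
    (l h : I -> vec k)
    (rho : set (vec k * vec k)) :
  0 < n i0 ->
  (forall a, generated_congruence rho (l a, h a)) ->
  (forall a, factorization_hom n (l a) = factorization_hom n (h a)) ->
  (forall a, l a i0 < h a i0) ->
  (forall u v, (forall a, ~~ vle (l a) u) -> (forall a, ~~ vle (l a) v) ->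
     factorization_hom n u = factorization_hom n v -> u = v) ->
  kernel_congruence n `<=` generated_congruence rho.
Proof.
move=> n0 gen_lh phi_lh lt_lh red_inj.
have [refl sym trans add] := generated_congruenceP rho.
have coord_le (u : vec k) : u i0 <= factorization_hom n u.
  rewrite /factorization_hom (bigD1 i0) //=.
  exact: leq_trans (leq_pmulr _ n0) (leq_addr _ _).
have reduce : forall u : vec k, exists v, [/\ forall a, ~~ vle (l a) v,
    generated_congruence rho (u, v)
  & factorization_hom n u = factorization_hom n v].
  move=> u; have [d] := ubnP (factorization_hom n u - u i0).
  elim: d u => // d IH u lt_ud.
  have [red_u|/existsNP[a /negP/negPn/vle_subK[w uE]]] :=
    pselect (forall a, ~~ vle (l a) u); first by exists u.
  have phiE : factorization_hom n u = factorization_hom n (h a + w)%R.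
    by rewrite uE !factorization_homD phi_lh.
  have [|v [red_v g_v phi_v]] := IH (h a + w)%R.
    have := coord_le (h a + w)%R; have := lt_lh a.
    by move: lt_ud; rewrite -phiE {2}uE !ffun_addE; lia.
  exists v; split=> //; last by rewrite phiE.
  by apply: trans g_v; rewrite uE; apply: add (refl w); apply: gen_lh.
move=> [u v] /= phi_uv.
have [u' [red_u g_u phi_u]] := reduce u.
have [v' [red_v g_v phi_v]] := reduce v.
rewrite (red_inj u' v') // in g_u; last by rewrite -phi_u -phi_v.
exact: trans g_u (sym _ _ g_v).
Qed.

(** A congruence moves a vector only by replacing a part of it that is a side of
    a generating pair.  This is proved by exhibiting the congruence that
    identifies no two distinct vectors as soon as one of them is below [w]; it
    contains [rho], and it isolates [w]. *)
Lemma isolated_class (k : nat)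
    (rho : set (vec k * vec k))
    (w v : vec k) :
  (forall r, rho r -> ~~ vle r.1 w /\ ~~ vle r.2 w) ->
  generated_congruence rho (w, v) -> v = w.
Proof.
move=> rhoNw gen_wv.
pose R := [set uv : vec k * vec k |
  vle uv.1 w || vle uv.2 w -> uv.1 = uv.2].
have congR : congruence R.
  rewrite /R; split=> [u|u v'|u t z|u u1 t t1] //=.
  - by rewrite orbC => h /h.
  - move=> ut tz /orP[uw|zw].
      have utE : u = t by apply: ut; rewrite uw.
      by rewrite utE; apply: tz; rewrite -utE uw.
    have tzE : t = z by apply: tz; rewrite zw orbT.
    by rewrite -tzE; apply: ut; rewrite tzE zw orbT.
  - move=> uu1 tt1.
    have le_l (a b : vec k) : vle (a + b)%R w -> vle a w.
      exact: vle_trans (vle_addr a b).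
    have le_r (a b : vec k) : vle (a + b)%R w -> vle b w.
      by rewrite GRing.addrC => /le_l.
    case/orP => le_w; move: (le_l _ _ le_w) (le_r _ _ le_w) => lw rw.
      by congr (_ + _)%R; [apply: uu1; rewrite lw|apply: tt1; rewrite rw].
    congr (_ + _)%R; [apply: uu1|apply: tt1].
      by rewrite lw orbT.
    by rewrite rw orbT.
have: R (w, v).
  apply: (gen_wv R); split=> // r /rhoNw[/negPf r1 /negPf r2].
  by rewrite /R /= r1 r2.
by move=> wv; apply/esym/wv/orP; left; apply/forallP.
Qed.

(** * Submonoids of N *)

Lemma generated_submonoidP (A : set nat) :
  additive_submonoid (generated_submonoid A).
Proof.
split=> [T [[]] //|a b Sa Sb T hT].
by case: (hT) => -[_ addT] _; apply: addT; [apply: Sa|apply: Sb].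
Qed.

Lemma generated_submonoidMn (A : set nat) (a c : nat) :
  generated_submonoid A a -> generated_submonoid A (c * a).
Proof.
have [S0 SD] := generated_submonoidP A.
by move=> Sa; elim: c => [//|c IH]; rewrite mulSn; apply: SD.
Qed.

(** The residue r modulo [m] is reached by r copies of [c * m + 1], so a number
    is representable once its quotient by [m] is at least [c * r]. *)
Lemma numerical_semigroup_succ_multiple (A : set nat) (m c : nat) :
  0 < m -> A m -> A (c * m + 1) -> numerical_semigroup (generated_submonoid A).
Proof.
move=> m0 Am Acm; have SP := generated_submonoidP A; split=> //.
apply: (@sub_finite_set _ _ `I_(c * m * m)); last exact: finite_II.
move=> s /= sNS; rewrite ltnNge; apply/negP => le_s; apply: sNS.
pose q := s %/ m; pose r := s %% m.
have lt_rm : r < m by rewrite ltn_mod.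
have le_q : c * r <= q.
  apply: (@leq_trans (c * m)); first by rewrite leq_mul2l (ltnW lt_rm) orbT.
  by rewrite leq_divRL.
have -> : s = r * (c * m + 1) + (q - c * r) * m.
  rewrite {1}(divn_eq s m) -/q -/r mulnBl mulnDr muln1.
  have : c * r * m <= q * m by rewrite leq_mul2r le_q orbT.
  by rewrite mulnCA mulnA; lia.
by apply: SP.2; apply: generated_submonoidMn; apply: sub_gen_smallest.
Qed.

(** Removing an atom from a monoid leaves a submonoid, which would contain [A]
    if [A] missed the atom. *)
Lemma atom_generator (S A : set nat) (n : nat) :
  generated_submonoid A = S -> S n -> 0 < n ->
  (forall a b, S a -> S b -> a + b = n -> a = 0 \/ b = 0) -> A n.
Proof.
move=> <- Sn n0 atom; apply: contrapT => nNA.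
have [S0 SD] := generated_submonoidP A.
suff [_ /(_ erefl)] : (generated_submonoid A `\ n) n by [].
apply: (Sn (generated_submonoid A `\ n)); split; last first.
  move=> a Aa; split; first exact: sub_gen_smallest.
  by move=> /= an; apply: nNA; rewrite -an.
split=> [|a b [Sa an] [Sb bn]]; first by split=> //= n00; rewrite -n00 in n0.
split=> [|/= abn]; first exact: SD.
by have [a0|b0] := atom a b Sa Sb abn; [apply: bn|apply: an] => /=; lia.
Qed.

(** * Digits in base p *)

Lemma digits_inj (p n : nat) (d e : 'I_n -> nat) :
  (forall i, d i < p) -> (forall i, e i < p) ->
  \sum_(i < n) d i * p ^ i = \sum_(i < n) e i * p ^ i -> d =1 e.
Proof.
elim: n d e => [|n IH] d e dp ep; first by move=> _ [].
have recl (f : 'I_n.+1 -> nat) : \sum_(i < n.+1) f i * p ^ i =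
    (\sum_(i < n) f (lift ord0 i) * p ^ i) * p + f ord0.
  rewrite big_ord_recl expn0 muln1 addnC big_distrl; congr (_ + _).
  by apply: eq_bigr => i _; rewrite lift0 expnSr mulnA.
have p0 : 0 < p by apply: leq_ltn_trans (dp ord0).
rewrite !recl => E.
have E0 : d ord0 = e ord0.
  by move/(congr1 (modn^~ p)): E; rewrite !modnMDl !modn_small.
move: E; rewrite E0 => /addIn/eqP; rewrite eqn_pmul2r // => /eqP E.
have {}IH := IH _ _ (fun i => dp (lift ord0 i)) (fun i => ep (lift ord0 i)) E.
by move=> i; case: (unliftP ord0 i) => [j ->|->].
Qed.

Lemma sum_max_digits (p n : nat) : \sum_(i < n) (p - 1) * p ^ i = p ^ n - 1.
Proof. by rewrite -big_distrr /= !subn1 predn_exp. Qed.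

(** The complementary digits [p - 1 - d i] represent [p ^ n - 1] minus the number
    represented by [d], which is at most 1 here; so they vanish above the units
    place, where they are at most 1. *)
Lemma digits_top (p n : nat) (d : 'I_n -> nat) (i : 'I_n) :
  1 < p -> (forall i, d i < p) -> p ^ n - 2 <= \sum_(i < n) d i * p ^ i ->
  (if i == 0 :> nat then p - 2 else p - 1) <= d i.
Proof.
move=> p1 dp le_top; have dpi := dp i.
have compl : \sum_(i < n) (p - 1 - d i) * p ^ i + \sum_(i < n) d i * p ^ i =
    p ^ n - 1.
  rewrite -sum_max_digits -big_split /=; apply: eq_bigr => j _.
  by rewrite -mulnDl subnK //; have := dp j; lia.
have : (p - 1 - d i) * p ^ i <= 1.
  apply: (@leq_trans (\sum_(i < n) (p - 1 - d i) * p ^ i)); last by lia.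
  by rewrite [leqRHS](bigD1 i) //= leq_addr.
case: eqP => [->|/eqP i0]; first by rewrite expn0; lia.
have : p <= p ^ i by rewrite -{1}(expn1 p) leq_pexp2l // ?lt0n //; lia.
by nia.
Qed.

(** * The semigroup *)

Section Generators.

Variables p x : nat.
Hypotheses (p2 : 2 <= p) (x2 : 2 <= x) (px : (p, x) <> (2, 2)).

Let m := p ^ x - 2.

Lemma gens0 : gens p x ord0 = m.
Proof. by []. Qed.

Lemma gensS (i : 'I_x) : gens p x (lift ord0 i) = 2 * m + p ^ i.
Proof. by rewrite /gens lift0 subn1. Qed.

Lemma exp_lt_gen0 (i : 'I_x) : p ^ i < m.
Proof.
have : p ^ i <= p ^ x.-1.
  by rewrite leq_exp2l //; have := ltn_ord i; lia.
have : p ^ x = p * p ^ x.-1 by rewrite -expnS prednK //; lia.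
rewrite /m; have [p3|p2'] := ltnP 2 p.
  have : p ^ 1 <= p ^ x.-1 by rewrite leq_exp2l //; lia.
  by nia.
have pE : p = 2 by lia.
have x3 : 2 < x.
  by rewrite ltn_neqAle x2 andbT; apply/eqP => xE; apply: px; rewrite pE -xE.
have : p ^ 2 <= p ^ x.-1 by rewrite leq_exp2l //; lia.
by rewrite pE; nia.
Qed.

Lemma gen0_gt0 : 0 < m.
Proof. by apply: leq_ltn_trans (exp_lt_gen0 (Ordinal (ltnW x2))). Qed.

Lemma gens_bounds (i : 'I_x) :
  2 * m < gens p x (lift ord0 i) < 3 * m.
Proof.
have : 0 < p ^ i by rewrite expn_gt0; lia.
by have := exp_lt_gen0 i; rewrite gensS; lia.
Qed.

Lemma gens_inj : injective (gens p x).
Proof.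
move=> i j; case: (unliftP ord0 i) => [i' ->|->];
  case: (unliftP ord0 j) => [j' ->|-> //].
- rewrite !gensS => /addnI/eqP; rewrite eqn_exp2l // => /eqP ij.
  by congr (lift _ _); apply: val_inj.
- by have := gens_bounds i'; rewrite gens0; lia.
- by have := gens_bounds j'; rewrite gens0; lia.
Qed.

(** This crude containment suffices to prove irreducibility: if two non-zero
    elements of the larger set are not both multiples of m, their sum is at least
    3m, and all the generators are below 3m. *)
Lemma gens_submonoid_small :
  generated_submonoid (range (gens p x)) `<=` [set s | m %| s \/ 2 * m <= s].
Proof.
apply: smallest_sub => [|_ [i _ <-]] /=.
  split=> [|a b /= [ma|lea] [mb|leb]]; rewrite ?dvdn0; try by right; lia.
  - by left.
  - by left; rewrite dvdn_add.
case: (unliftP ord0 i) => [j ->|->]; first by have := gens_bounds j; lia.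
by rewrite gens0; left.
Qed.

Lemma gens_atom (i : 'I_x.+1) (a b : nat) :
  generated_submonoid (range (gens p x)) a ->
  generated_submonoid (range (gens p x)) b ->
  a + b = gens p x i -> a = 0 \/ b = 0.
Proof.
move=> /gens_submonoid_small /= Sa /gens_submonoid_small /= Sb abE.
have m0 := gen0_gt0.
have [->|a0] := posnP a; first by left.
have [->|b0] := posnP b; first by right.
have ge_m c : 0 < c -> m %| c \/ 2 * m <= c -> m <= c.
  by move=> c0 [/(dvdn_leq c0) //|]; lia.
have le_a := ge_m _ a0 Sa; have le_b := ge_m _ b0 Sb.
move: abE; case: (unliftP ord0 i) => [j ->|->]; last by rewrite gens0; lia.
move=> abE; have := gens_bounds j; rewrite -abE => bnd.
have ma : m %| a by case: Sa => //; lia.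
have mb : m %| b by case: Sb => //; lia.
have /dvdnP[q abq] : m %| a + b by rewrite dvdn_add.
by move: bnd; rewrite abq !ltn_pmul2r //; lia.
Qed.

Lemma gens_minimal :
  minimally_generated_by (generated_submonoid (range (gens p x))) (gens p x).
Proof.
split; first exact: gens_inj.
split=> // B [BG GB] genB; apply: GB => _ [i _ <-].
apply: (atom_generator genB).
- by apply: sub_gen_smallest; exists i.
- case: (unliftP ord0 i) => [j ->|->]; last exact: gen0_gt0.
  by have := gens_bounds j; lia.
- exact: gens_atom.
Qed.

Lemma gens_numerical_semigroup :
  numerical_semigroup (generated_submonoid (range (gens p x))).
Proof.
apply: (@numerical_semigroup_succ_multiple _ m 2); first exact: gen0_gt0.
  by exists ord0.
by exists (lift ord0 (Ordinal (ltnW x2))) => //; rewrite gensS.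
Qed.

(** Modulo m, only the number with base-p digits u_1, ..., u_x remains. *)
Lemma factorization_homE (u : vec x.+1) :
  factorization_hom (gens p x) u =
  (u ord0 + 2 * \sum_(i < x) u (lift ord0 i)) * m
  + \sum_(i < x) u (lift ord0 i) * p ^ i.
Proof.
rewrite /factorization_hom big_ord_recl gens0.
under eq_bigr do rewrite gensS mulnDr.
rewrite big_split /= -big_distrl /=; lia.
Qed.

(** * The relations and their light sides *)

(** Indexing by 0, ..., x makes [light k] the vector p e_k for every k >= 1. *)
Definition relation (k : nat) :=
  if k == 0 then rel_second p x
  else if k == x then rel_first p x else rel_v p x k.

Definition light (k : nat) : vec x.+1 :=
  if (k == 0) || (k == x) then (relation k).2 else (relation k).1.

Definition heavy (k : nat) : vec x.+1 :=
  if (k == 0) || (k == x) then (relation k).1 else (relation k).2.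

Lemma relation_sides (k : nat) :
  relation k = (light k, heavy k) \/ relation k = (heavy k, light k).
Proof.
by rewrite /light /heavy; case: ifP => _; [right|left]; case: (relation k).
Qed.

Lemma relsE : rels p x = relation @` `I_x.+1.
Proof.
apply/seteqP; split=> [r [[->|->]|[i /= /andP[i1 ix] <-]]|_ [k /= kx <-]].
- by exists x => //=; rewrite /relation eqxx ifF //; lia.
- by exists 0.
- by exists i => /=; [lia|rewrite /relation !ifF //; lia].
rewrite /relation; case: (k =P 0) => [_|k0]; first by left; right.
case: (k =P x) => [_|kNx]; first by left; left.
by right; exists k => //=; lia.
Qed.

Lemma lightE (k : nat) (j : 'I_x.+1) : light k j =
  if k == 0 then
    if j == 0 :> nat then 0 else if j == 1 :> nat then p - 2 else p - 1
  else if j == k :> nat then p else 0.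
Proof.
rewrite /light /relation; case: (k =P 0) => [->|k0] /=; first by rewrite ffunE.
by case: (k =P x) => [->|kx] /=; rewrite ffunE.
Qed.

Lemma light_ord0 (k : nat) : light k ord0 = 0.
Proof. by rewrite lightE; case: k => [|[]]. Qed.

Lemma heavy_ord0 (k : nat) : 0 < heavy k ord0.
Proof.
rewrite /heavy /relation; case: (k =P 0) => _ /=.
  by rewrite ffunE /=; nia.
by case: (k =P x) => _ /=; rewrite ffunE /=; lia.
Qed.

Lemma gens_axis (i c : nat) : i <= x ->
  factorization_hom (gens p x)
    [ffun j : 'I_x.+1 => if j == i :> nat then c else 0] =
  c * (if i == 0 then m else 2 * m + p ^ i.-1).
Proof.
move=> ix; have iE : i = (inord i : 'I_x.+1) by rewrite inordK.
by rewrite {1}iE factorization_hom_axis /gens -iE subn1.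
Qed.

Lemma gens_two_axes (i b c : nat) : 0 < i <= x ->
  factorization_hom (gens p x)
    [ffun j : 'I_x.+1 =>
       if j == 0 :> nat then b else if j == i :> nat then c else 0] =
  b * m + c * (2 * m + p ^ i.-1).
Proof.
move=> /andP[i0 ix]; have := gens_axis c ix; rewrite gtn_eqF // => <-.
rewrite -(@gens_axis 0) // -factorization_homD; congr factorization_hom.
apply/ffunP => j; rewrite ffun_addE !ffunE.
by case: eqP => [->|]; case: eqP => //; lia.
Qed.

(** Raising the units digit of (p-2, p-1, ..., p-1) to p-1 adds [f 0].  With f
    constant this gives the digit sum, and with f the powers of p the number
    represented. *)
Lemma sum_second_digits (f : nat -> nat) : f 0 = 1 ->
  \sum_(i < x) (if i == 0 :> nat then p - 2 else p - 1) * f i + 1 =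
  \sum_(i < x) (p - 1) * f i.
Proof.
by case: (x) x2 => // n _ f0; rewrite !big_ord_recl /= f0; lia.
Qed.

Lemma relation_kernel (k : nat) : k <= x ->
  factorization_hom (gens p x) (relation k).1 =
  factorization_hom (gens p x) (relation k).2.
Proof.
move=> kx; have m0 := gen0_gt0.
have expx : p ^ x = m + 2 by move: m0; rewrite /m; lia.
rewrite /relation; case: (k =P 0) => [_|k0] /=.
  rewrite gens_axis // factorization_homE.
  have S1 := @sum_second_digits (fun=> 1) erefl.
  have S2 := @sum_second_digits (expn p) (expn0 p).
  rewrite sum_max_digits expx in S2.
  rewrite sum_nat_const card_ord muln1 in S1.
  have E (f : nat -> nat) :
      \sum_(i < x) (rel_second p x).2 (lift ord0 i) * f i =
      \sum_(i < x) (if i == 0 :> nat then p - 2 else p - 1) * f i.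
    by apply: eq_bigr => i _; rewrite ffunE lift0.
  have E1 : \sum_(i < x) (rel_second p x).2 (lift ord0 i) =
      \sum_(i < x) (rel_second p x).2 (lift ord0 i) * 1.
    by apply: eq_bigr => i _; rewrite muln1.
  rewrite E1 (E (fun=> 1)) E ffunE /=.
  by move: S1 S2; set s1 := \sum_(_ < _) _; set s2 := \sum_(_ < _) _; nia.
have k_gt0 : 0 < k by lia.
case: (k =P x) => [kxE|kNx] /=.
  have : p * p ^ x.-1 = p ^ x by rewrite -expnS prednK //; lia.
  rewrite gens_two_axes ?gens_axis ?(gtn_eqF (ltnW x2)) //; last by lia.
  by rewrite expx expn0; nia.
have : p * p ^ k.-1 = p ^ k by rewrite -expnS prednK.
rewrite gens_axis // gens_two_axes; last by lia.
by rewrite addn1 gtn_eqF //=; nia.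
Qed.

Lemma light_heavy_kernel (k : nat) : k <= x ->
  factorization_hom (gens p x) (light k) =
  factorization_hom (gens p x) (heavy k).
Proof.
by move=> /relation_kernel; case: (relation_sides k) => ->.
Qed.

(** The vectors p e_k are plainly incomparable, and p e_k is not below
    (0, p-2, p-1, ..., p-1), whose entries are less than p.  Conversely that
    vector has at least two non-zero entries: those at x and at 2 if x > 2, those
    at x = 2 and at 1 if p > 2. *)
Lemma light_antichain (j k : nat) : j <= x -> k <= x ->
  vle (light j) (light k) -> j = k.
Proof.
move=> jx kx /forallP le_jk.
have at_ i (ix : i < x.+1) : light j (Ordinal ix) <= light k (Ordinal ix).
  exact: le_jk.
have [j0|j0] := posnP j; have [k0|k0] := posnP k; first by rewrite j0 k0.
- have support i : 0 < i -> i <= x -> (i == 1 -> 2 < p) -> i = k.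
    move=> i0 ix i1; have := at_ i ix; rewrite j0 !lightE /=.
    by case: (i =P k) => //; case: (i =P 0) => [|_]; first lia;
      case: eqP i1 => [_ /(_ isT)|_ _]; case: eqP; lia.
  have xk : x = k by apply: support => //; lia.
  have [x3|x2'] := ltnP 2 x; first by have := @support 2 isT x2; lia.
  have xE : x = 2 by lia.
  have p3 : 2 < p.
    by rewrite ltn_neqAle p2 andbT; apply/eqP => pE; apply: px; rewrite -pE xE.
  by have := @support 1 isT (ltnW x2) (fun=> p3); lia.
- have := at_ j jx; rewrite !lightE /= eqxx k0 /= (gtn_eqF j0).
  by case: ifP; lia.
- have := at_ j jx; rewrite !lightE /= eqxx (gtn_eqF j0) (gtn_eqF k0).
  by case: (j =P k) => //; lia.
Qed.

Lemma relation_inj : {in `I_x.+1 &, injective relation}.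
Proof.
move=> j k; rewrite !inE /= => jx kx jk; apply: light_antichain => //.
suff -> : light j = light k by apply/forallP.
have lh a b : light a <> heavy b.
  move=> /(congr1 (fun u : vec x.+1 => u ord0)) E.
  by have := heavy_ord0 b; rewrite -E light_ord0.
move: jk; case: (relation_sides j) => ->; case: (relation_sides k) => -> [] //.
  by move=> /lh.
by move=> _ /lh.
Qed.

(** Containing no [light k] with k >= 1 makes u_1, ..., u_x digits; containing no
    [light 0] forces the number they represent below m, by [digits_top]. *)
Lemma reduced_inj (u v : vec x.+1) :
  (forall k : 'I_x.+1, ~~ vle (light k) u) ->
  (forall k : 'I_x.+1, ~~ vle (light k) v) ->
  factorization_hom (gens p x) u = factorization_hom (gens p x) v -> u = v.
Proof.
pose N (w : vec x.+1) := \sum_(i < x) w (lift ord0 i) * p ^ i.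
have digit w : (forall k : 'I_x.+1, ~~ vle (light k) w) ->
    forall i : 'I_x, w (lift ord0 i) < p.
  move=> red i; rewrite ltnNge; apply: contra (red (lift ord0 i)) => le_p.
  apply/forallP => j; rewrite lightE lift0 /=.
  case: eqP => // ji; suff -> : j = lift ord0 i by [].
  exact: val_inj.
have small w : (forall k : 'I_x.+1, ~~ vle (light k) w) -> N w < m.
  move=> red; rewrite ltnNge; apply: contra (red ord0) => le_m.
  apply/forallP => j; rewrite lightE /=.
  case: (unliftP ord0 j) => [i ->|-> //]; rewrite lift0 /=.
  exact: (digits_top _ p2 (digit w red) le_m).
move=> red_u red_v; rewrite !factorization_homE -/(N u) -/(N v) => E.
have EN : N u = N v.
  by move/(congr1 (modn^~ m)): E; rewrite !modnMDl !modn_small ?small.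
have Ed := digits_inj (digit u red_u) (digit v red_v) EN.
move: E; rewrite EN => /addIn/eqP; rewrite eqn_pmul2r ?gen0_gt0 //.
under eq_bigr do rewrite Ed.
rewrite eqn_add2r => /eqP E0; apply/ffunP => i.
by case: (unliftP ord0 i) => [j ->|->].
Qed.

(** * Generation and minimality *)

Lemma rels_presentation : presentation (gens p x) (rels p x).
Proof.
have [_ sym _ _] := generated_congruenceP (rels p x).
apply/seteqP; split.
  apply: smallest_sub; first exact: kernel_congruenceP.
  by rewrite relsE => _ [k kx <-]; apply: relation_kernel.
apply: (@kernel_sub_generated _ _ ord0 'I_x.+1 light heavy).
- exact: gen0_gt0.
- move=> k; have : generated_congruence (rels p x) (relation k).
    by apply: sub_gen_smallest; rewrite relsE; exists (nat_of_ord k) => /=.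
  by case: (relation_sides k) => -> // /sym.
- by move=> k; apply: light_heavy_kernel; rewrite -ltnS.
- by move=> k; rewrite light_ord0 heavy_ord0.
- exact: reduced_inj.
Qed.

Lemma rels_minimal_presentation :
  minimal_presentation (gens p x) (rels p x).
Proof.
split=> [|rho' [rho'S /existsNP[r /not_implyP[rels_r rNrho']]] pres].
  exact: rels_presentation.
move: rels_r rNrho'; rewrite relsE => -[k /= kx <-] kNrho'.
have : generated_congruence rho' (light k, heavy k).
  by rewrite pres /kernel_congruence /=; apply: light_heavy_kernel.
move/isolated_class => hl.
suff /hl E : forall r, rho' r -> ~~ vle r.1 (light k) /\ ~~ vle r.2 (light k).
  by have := heavy_ord0 k; rewrite E light_ord0.
move=> s rho's; have := rho'S _ rho's; rewrite relsE => -[j /= jx jE].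
have light_j : ~~ vle (light j) (light k).
  apply/negP => /(light_antichain jx kx) jk.
  by apply: kNrho'; rewrite -jk jE.
have heavy_j : ~~ vle (heavy j) (light k).
  apply/negP => /forallP/(_ ord0); rewrite light_ord0.
  by have := heavy_ord0 j; lia.
by rewrite -jE; case: (relation_sides j) => ->.
Qed.

Lemma card_rels : (rels p x #= `I_(x + 1))%card.
Proof. by rewrite relsE addn1; apply: inj_card_eq relation_inj. Qed.

End Generators.

Theorem theorem3 (p x : nat) (hp : 2 <= p) (hx : 2 <= x)
    (hpx : (p, x) <> (2, 2)) (S : set nat)
    (hS : S = generated_submonoid (range (gens p x))) :
  [/\ numerical_semigroup S,
      minimally_generated_by S (gens p x),
      minimal_presentation (gens p x) (rels p x)
    & (rels p x #= `I_(x + 1))%card].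
Proof.
rewrite hS; split.
- exact: gens_numerical_semigroup.
- exact: gens_minimal.
- exact: rels_minimal_presentation.
- exact: card_rels.
Qed.
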